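(* Let $R$ be a ring with identity (not necessarily commutative) and let $n\ge 1$. Assume that $\xi$ belongs to an overring of $R$, that $\xi$ commutes with all elements of $R$, and that $f=X^{n}+a_{n-1}X^{n-1}+\cdots+a_1X+a_0\in R[X]$ is the minimal polynomial of $\xi$ over $R$, i.e., $\xi$ is a root of $f$ but is not a root of any nonzero polynomial in $R[X]$ of degree less than $n$. Let $\alpha,\beta\in R[\xi]$ have coordinate column vectors $[\alpha],[\beta]\in R^n$ relative to the basis $1,\xi,\dots,\xi^{n-1}$. Then $$[\alpha\beta]=(I\; C\;\cdots\; C^{n-1})\,([\alpha]\otimes[\beta]),$$ where $C\in M_n(R)$ is the companion matrix of $f$, $$C=\begin{pmatrix} 0 & 0 & \cdots & 0 & -a_0\\ 1 & 0 & \cdots & 0 & -a_1\\ 0 & 1 & \cdots & 0 & -a_2\\ \vdots & \vdots & \cdots & \vdots & \vdots\\ 0 & 0 & \cdots & 1 & -a_{n-1}\end{pmatrix},$$ and for $x,y\in R^n$ the left Kronecker product $x\otimes y\in R^{n^2}$ is $$x\otimes y=\begin{pmatrix} xy_1\\ \vdots\\ xy_n\end{pmatrix}.$$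
   Context: An overring of $R$ is a ring containing $R$ as a subring with the same identity. $R[X]$ is the polynomial ring in a variable $X$ commuting with the elements of $R$, and $R[\xi]=\{p(\xi): p\in R[X]\}$. Elements of $R^n$ are column vectors. For $\alpha=b_0+b_1\xi+\cdots+b_{n-1}\xi^{n-1}\in R[\xi]$ with $b_i\in R$, $[\alpha]\in R^n$ denotes the column vector with entries $b_0,b_1,\dots,b_{n-1}$. For $x\in R^n$ with entries $x_1,\dots,x_n$ and $r\in R$, $xr$ is the column vector with entries $x_1r,\dots,x_nr$; thus $x\otimes y$ stacks the $n$ blocks $xy_1,\dots,xy_n$, where $y_1,\dots,y_n$ are the entries of $y$. $I$ is the $n\times n$ identity matrix, and $(I\; C\;\cdots\; C^{n-1})$ is the $n\times n^2$ block matrix obtained by placing $I,C,\dots,C^{n-1}$ side by side. For $n=1$ the companion matrix is $C=(-a_0)$. *)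

(* Defs.v *)
From HB Require Import structures.
From mathcomp Require Import all_boot all_algebra.
From mathcomp Require Import classical_sets.

Set Implicit Arguments.
Unset Strict Implicit.
Unset Printing Implicit Defensive.

Import GRing.Theory.
Local Open Scope ring_scope.

(* An overring of R is a ring S with an injective morphism iota : R -> S. *)

Definition evalp (R S : nzRingType) (iota : {rmorphism R -> S}) (xi : S)
  (p : {poly R}) : S := (map_poly iota p).[xi].

Definition in_adjoin (R S : nzRingType) (iota : {rmorphism R -> S}) (xi : S)
  (alpha : S) : Prop := exists p : {poly R}, alpha = evalp iota xi p.

Definition is_minpoly (R S : nzRingType) (iota : {rmorphism R -> S}) (xi : S)
    (n : nat) (f : {poly R}) : Prop :=
  [/\ f \is monic, size f = n.+1, evalp iota xi f = 0 &
      forall g : {poly R}, g != 0 -> (size g <= n)%N -> evalp iota xi g <> 0].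

(* The column b with alpha = b_0 + b_1 xi + ... + b_(n-1) xi^(n-1).  When xi
   has a minimal polynomial of degree n and alpha is in R[xi], such a b exists
   and is unique; outside that case the value is arbitrary. *)
Definition coordvec (R S : nzRingType) (iota : {rmorphism R -> S}) (xi : S)
    (n : nat) (alpha : S) : 'cV[R]_n :=
  xget 0 (fun b : 'cV[R]_n => alpha = \sum_(i < n) iota (b i 0) * xi ^+ i).

(* Transpose of the library's [companionmx f] (whose size is (size f).-1). *)
Definition companion (R : nzRingType) (n : nat) (f : {poly R}) : 'M[R]_n :=
  \matrix_(i < n, j < n)
    if (j == n.-1 :> nat) then - f`_i else (i == j.+1 :> nat)%:R.

(* The dimension \sum_(j < n) n is the block form of n ^ 2. *)
Definition lkron (R : nzRingType) (n : nat) (x y : 'cV[R]_n) :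
    'cV[R]_(\sum_(j < n) n) :=
  \mxcol_(j < n) \col_(i < n) (x i 0 * y j 0).

Definition power_row (R : nzRingType) (n : nat) (C : 'M[R]_n) :
    'M[R]_(n, \sum_(j < n) n) :=
  \mxrow_(j < n) (C ^+ j).

(* Main.v *)
(* Write each vector b as the value \sum_i b_i xi^i. Minimality of f makes this
   value determine b, and column j of the companion matrix has value xi^(j+1).
   Since xi commutes with R, applying C to a vector thus multiplies its value by
   xi on the right, even though R is noncommutative, and
   alpha * beta = \sum_j alpha y_j xi^j gives the formula. *)
Require Import Defs.
From HB Require Import structures.
From mathcomp Require Import all_boot all_algebra.
From mathcomp Require Import classical_sets.

Set Implicit Arguments.
Unset Strict Implicit.
Unset Printing Implicit Defensive.

Import GRing.Theory.
Local Open Scope ring_scope.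

Definition colval (R S : nzRingType) (iota : {rmorphism R -> S}) (xi : S)
    (n : nat) (b : 'cV[R]_n) : S := \sum_(i < n) iota (b i 0) * xi ^+ i.

Section ColumnValue.

Variables (R S : nzRingType) (iota : {rmorphism R -> S}) (xi : S).
Hypothesis xi_comm : commr_rmorph iota xi.

(** Passing to polynomials of size at most [n] makes division by [f] and the minimality of [f]
    applicable to columns. *)
Lemma colval_evalp n (b : 'cV[R]_n) :
  colval iota xi b = evalp iota xi (rVpoly b^T).
Proof.
rewrite /evalp (@horner_coef_wide _ n).
  by apply: eq_bigr => i _; rewrite coef_map coef_rVpoly_ord mxE.
exact: leq_trans (size_poly _ _) (size_poly _ _).
Qed.

Lemma evalpB p q : evalp iota xi (p - q) = evalp iota xi p - evalp iota xi q.
Proof. by rewrite /evalp rmorphB /= hornerD hornerN. Qed.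

Lemma commr_rmorphX (r : R) k : iota r * xi ^+ k = xi ^+ k * iota r.
Proof. exact: commrX (commr_sym (xi_comm r)). Qed.

Lemma colval_sum n (I : finType) (b : I -> 'cV[R]_n) :
  colval iota xi (\sum_k b k) = \sum_k colval iota xi (b k).
Proof.
rewrite /colval exchange_big; apply: eq_bigr => i _ /=.
by rewrite summxE rmorph_sum mulr_suml.
Qed.

(** The entries are scaled on the right, as in the blocks of [lkron]; the scalar then leaves the sum
    because it commutes with each power of [xi]. *)
Lemma colvalMr n (b : 'cV[R]_n) (r : R) :
  colval iota xi (\col_i (b i 0 * r)) = colval iota xi b * iota r.
Proof.
rewrite /colval mulr_suml; apply: eq_bigr => i _.
by rewrite mxE rmorphM -!mulrA commr_rmorphX.
Qed.

(** Two columns with the same value differ by a polynomial of size at most [n] that vanishes at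
    [xi], and minimality forces it to be zero. *)
Lemma colval_inj n (f : {poly R}) : is_minpoly iota xi n f ->
  injective (colval iota xi (n := n)).
Proof.
move=> [_ _ _ minf] b c; rewrite !colval_evalp => eq_bc.
apply/trmx_inj/(can_inj rVpolyK)/eqP; rewrite -subr_eq0.
apply/negPn/negP => /minf; apply.
  by rewrite -raddfB size_poly.
by rewrite evalpB eq_bc subrr.
Qed.

Lemma colval_surj n (f : {poly R}) (a : S) : is_minpoly iota xi n f ->
  in_adjoin iota xi a -> exists b : 'cV[R]_n, a = colval iota xi b.
Proof.
move=> [monf szf f0 _] [p ->].
(* The witness is the remainder of [p] modulo the monic [f]. The rest of [p] is a left multiple of
   [f], which [xi] kills: evaluation is multiplicative because [xi] commutes with the
   coefficients. *)
exists (poly_rV (Pdiv.Ring.rmodp p f))^T.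
rewrite colval_evalp trmxK poly_rV_K; last first.
  by rewrite -ltnS -szf Pdiv.Ring.ltn_rmodp monic_neq0.
apply/eqP; rewrite -subr_eq0 -evalpB.
rewrite {1}(Pdiv.RingMonic.rdivp_eq monf p) addrK.
rewrite [evalp _ _ _](rmorphM (horner_morph xi_comm)) /=.
by rewrite [X in _ * X]f0 mulr0.
Qed.

Lemma coordvecK n (f : {poly R}) (a : S) : is_minpoly iota xi n f ->
  in_adjoin iota xi a -> colval iota xi (coordvec iota xi n a) = a.
Proof.
move=> minf /(colval_surj minf)[b ab]; rewrite /coordvec.
(* The default value of [xget] is excluded by the column [b]. *)
by case: xgetP => [c _ -> //|/(_ b)]; case.
Qed.

Lemma colvalK n (f : {poly R}) (b : 'cV[R]_n) : is_minpoly iota xi n f ->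
  coordvec iota xi n (colval iota xi b) = b.
Proof.
move=> minf; apply: (colval_inj minf); rewrite /coordvec.
by case: xgetP => [c _ -> //|/(_ b)]; case.
Qed.

Lemma colval_col_companion n (f : {poly R}) (j : 'I_n) :
  is_minpoly iota xi n f ->
  colval iota xi (col j (companion n f)) = xi ^+ j.+1.
Proof.
move=> [monf szf f0 _]; rewrite /colval.
under eq_bigr do rewrite !mxE.
have n_gt0 : (0 < n)%N := leq_ltn_trans (leq0n j) (ltn_ord j).
case: eqP => [jn | /eqP jn].
  have fn1 : f`_n = 1 by move/monicP: monf; rewrite lead_coefE szf.
  (* In the last column, isolating the leading term of [f] at [xi] gives [xi ^+ n] as minus the sum
     of the lower terms. *)
  have := f0; rewrite /evalp (@horner_coef_wide _ n.+1); last first.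
    by rewrite -szf size_poly.
  rewrite big_ord_recr /= coef_map /= fn1 (rmorph1 iota) mul1r addrC.
  move/eqP; rewrite addr_eq0 => /eqP xin.
  rewrite jn prednK // xin -sumrN; apply: eq_bigr => i _.
  by rewrite coef_map rmorphN mulNr.
(* Any other column is the unit vector at index [j.+1], which is still below [n]. *)
have ltjn : (j.+1 < n)%N.
  by rewrite ltn_neqAle ltn_ord andbT; apply: contraNneq jn => /(congr1 predn) /= <-.
rewrite (bigD1 (Ordinal ltjn)) //= eqxx (rmorph1 iota) mul1r big1 ?addr0 // => i.
by rewrite -val_eqE /= => /negPf ->; rewrite rmorph0 mul0r.
Qed.

Lemma colval_companion n (f : {poly R}) (b : 'cV[R]_n) :
  is_minpoly iota xi n f ->
  colval iota xi (companion n f *m b) = colval iota xi b * xi.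
Proof.
move=> minf.
(* The product is a combination of the columns with coefficients on the right, the form that
   [colvalMr] handles. *)
have -> : companion n f *m b =
    \sum_j \col_i (col j (companion n f) i 0 * b j 0).
  apply/colP => i; rewrite summxE mxE.
  by apply: eq_bigr => j _; rewrite !mxE.
rewrite colval_sum /colval mulr_suml; apply: eq_bigr => j _.
rewrite -/(colval iota xi _) colvalMr (colval_col_companion _ minf).
by rewrite -mulrA -exprSr commr_rmorphX.
Qed.

Lemma colval_companionX n (f : {poly R}) (b : 'cV[R]_n) k :
  is_minpoly iota xi n f ->
  colval iota xi (companion n f ^+ k *m b) = colval iota xi b * xi ^+ k.
Proof.
move=> minf; elim: k => [|k IH]; first by rewrite !expr0 mul1mx mulr1.
by rewrite !exprS -mulmxA colval_companion // IH -mulrA -exprSr exprS.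
Qed.

End ColumnValue.

Theorem theorem1 (R S : nzRingType) (iota : {rmorphism R -> S})
  (iota_inj : injective iota) (n : nat) (n_ge1 : (1 <= n)%N)
  (xi : S) (xi_comm : commr_rmorph iota xi)
  (f : {poly R}) (f_min : is_minpoly iota xi n f)
  (alpha beta : S)
  (alpha_in : in_adjoin iota xi alpha) (beta_in : in_adjoin iota xi beta) :
  coordvec iota xi n (alpha * beta) =
    power_row (companion n f) *m
      lkron (coordvec iota xi n alpha) (coordvec iota xi n beta).
Proof.
set x := coordvec _ _ _ alpha; set y := coordvec _ _ _ beta.
(* It now suffices to compare values in [S]. *)
rewrite -[RHS](colvalK _ f_min); congr coordvec.
rewrite /power_row /lkron mul_mxrow_mxcol colval_sum.
rewrite -{1}(coordvecK xi_comm f_min alpha_in).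
rewrite -{1}(coordvecK xi_comm f_min beta_in) -/x -/y.
(* Only the value of [y] is expanded; the value of [x] stays whole, so that the sums agree block by
   block. *)
rewrite {2}/colval mulr_sumr; apply: eq_bigr => j _.
by rewrite (colval_companionX xi_comm _ _ f_min) (colvalMr xi_comm) mulrA.
Qed.
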